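(* Let $\{x^k\}$, $\{\alpha_k\}$ be generated by the AdaPBB algorithm (see context). Then for all $k\ge1$ $$F(\bar x^k)-F_*\le\frac{U_1}{2S_k}=O\left(\frac1k\right),$$ where $\bar x^k:=\Big(\alpha_k(1+E_k\alpha_k)x^k+\sum_{i=1}^{k-1}w_ix^i\Big)/S_k$ with $S_k:=E_1\alpha_1^2+\sum_{i=1}^k\alpha_i$.
   Context: $\|\cdot\|$ is the Euclidean norm and $B(x,r)$ the closed ball with center $x$ and radius $r$. Consider $\min_{x\in\mathbb{R}^n}F(x):=f(x)+g(x)$, where $f:\mathbb{R}^n\to\mathbb{R}$ is convex and differentiable with locally Lipschitz gradient and $g:\mathbb{R}^n\to\mathbb{R}\cup\{+\infty\}$ is closed, proper and convex. The set $\mathcal{X}^*$ of minimizers of $F$ is nonempty, $F_*=\min F$, and $x^*\in\mathcal{X}^*$ is fixed. $\mathrm{prox}_{\alpha g}(x)=\arg\min_{y}\,g(y)+\frac1{2\alpha}\|y-x\|^2$. AdaPBB algorithm. Input $x^0\in\mathbb{R}^n$ with a subgradient $\xi^0\in\partial g(x^0)$, $\alpha_0>0$, $\theta_0\ge0$. Set $x^1=\mathrm{prox}_{\alpha_0g}(x^0-\alpha_0\nabla f(x^0))$. For $k=1,2,\dots$ let $\lambda_k=\frac{\langle\nabla f(x^k)-\nabla f(x^{k-1}),x^k-x^{k-1}\rangle}{\|\nabla f(x^k)-\nabla f(x^{k-1})\|^2}$. (Case i) If $\lambda_k\ge\alpha_{k-1}$: $\alpha_k=\sqrt{1+\theta_{k-1}}\,\alpha_{k-1}$,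 $\theta_k=\alpha_k/\alpha_{k-1}$. (Case ii) If $\alpha_{k-1}/2<\lambda_k<\alpha_{k-1}$: $\alpha_k=\alpha_{k-1}/\sqrt2$, $\theta_k=0$. (Case iii) If $\lambda_k\le\alpha_{k-1}/2$: $\alpha_k=\lambda_k/\sqrt2$, $\theta_k=0$. Then $x^{k+1}=\mathrm{prox}_{\alpha_kg}(x^k-\alpha_k\nabla f(x^k))$. It is assumed that $\nabla f(x^k)\ne\nabla f(x^{k-1})$ for all $k\ge1$, so that $\lambda_k$ is well defined. For $k\ge0$, $\xi^{k+1}\in\partial g(x^{k+1})$ denotes the subgradient with $x^{k+1}=x^k-\alpha_k(\nabla f(x^k)+\xi^{k+1})$. For $k\ge1$ define - $B_k=0$, $E_k=\frac1{\alpha_{k-1}}$ if $\lambda_k\ge\alpha_{k-1}$; - $B_k=1$, $E_k=0$ if $\frac{\alpha_{k-1}}2<\lambda_k<\alpha_{k-1}$; - $B_k=\frac{(\alpha_{k-1}-\lambda_k)^2}{\lambda_k^2}$, $E_k=0$ if $0<\lambda_k\le\frac{\alpha_{k-1}}2$; and $E_0=(E_1\alpha_1^2-\alpha_0)/\alpha_0^2$. Let $w_k=\alpha_k+E_k\alpha_k^2-E_{k+1}\alpha_{k+1}^2$ for $k\ge0$, and for $k\ge1$ $$U_k=\|x^k-x^*\|^2+2B_k\alpha_k^2\|\nabla f(x^{k-1})+\xi^{k-1}\|^2+2E_k\alpha_k^2(F(x^{k-1})-F_* ).$$ Local smoothness: there is $L>0$ with $f(x)-f(y)-\langle\nabla f(y),x-y\rangle\ge\frac1{2L}\|\nabla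 f(x)-\nabla f(y)\|^2$ for all $x,y\in B(x^*,T)$, where $T^2=\|x^0-x^*\|^2+2\alpha_0^2\|\nabla f(x^0)+\xi^0\|^2+\max\{2(E_1\alpha_1^2-\alpha_0),0\}(F(x^0)-F_* )$. $O(\cdot)$ is as $k\to\infty$, with constants independent of $k$. *)

(* Defs.v *)
From HB Require Import structures.
From mathcomp Require Import all_boot all_order all_algebra.
From mathcomp Require Import all_classical all_reals all_analysis.
Set Implicit Arguments.
Unset Strict Implicit.
Unset Printing Implicit Defensive.
Import Order.TTheory GRing.Theory Num.Theory.
Import numFieldNormedType.Exports.
Local Open Scope classical_set_scope.
Local Open Scope ring_scope.

(* The norm `|_| of the library on 'rV[R]_n is the sup norm: it induces the
   usual topology and differentiability on R^n, but it is not the Euclidean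
   norm, which is therefore introduced here as enorm. *)
Definition dot (R : realType) (n : nat) (u v : 'rV[R]_n) : R :=
  \sum_(i < n) u ord0 i * v ord0 i.

Definition enorm (R : realType) (n : nat) (u : 'rV[R]_n) : R :=
  Num.sqrt (dot u u).

Definition cball (R : realType) (n : nat) (c : 'rV[R]_n) (r : R) :
    set 'rV[R]_n :=
  [set y | enorm (y - c) <= r].

Definition grad (R : realType) (n : nat) (f : 'rV[R]_n -> R) (x : 'rV[R]_n) :
    'rV[R]_n :=
  \row_(i < n) 'D_(delta_mx ord0 i) f x.

Definition locally_lipschitz (R : realType) (n : nat)
    (G : 'rV[R]_n -> 'rV[R]_n) : Prop :=
  forall x, exists r M : R, 0 < r /\
    forall y z, cball x r y -> cball x r z ->
      enorm (G y - G z) <= M * enorm (y - z).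

Definition proper_fun (R : realType) (n : nat) (g : 'rV[R]_n -> \bar R) : Prop :=
  (forall x, g x != -oo%E) /\ (exists x, (g x < +oo)%E).

Definition closed_fun (R : realType) (n : nat) (g : 'rV[R]_n -> \bar R) : Prop :=
  closed [set p : 'rV[R]_n * R | (g p.1 <= p.2%:E)%E].

(* In \bar R, 0 * +oo = 0, so the endpoints t = 0 and t = 1 are harmless. *)
Definition convex_efun (R : realType) (n : nat) (g : 'rV[R]_n -> \bar R) : Prop :=
  forall (x y : 'rV[R]_n) (t : R), 0 <= t -> t <= 1 ->
    (g (t *: x + (1 - t) *: y)%R <= t%:E * g x + (1 - t)%:E * g y)%E.

(* The subdifferential of a proper g; properness makes it empty wherever
   g = +oo. *)
Definition subdiff (R : realType) (n : nat) (g : 'rV[R]_n -> \bar R)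
    (x : 'rV[R]_n) : set 'rV[R]_n :=
  [set xi | forall y, (g x + (dot xi (y - x))%:E <= g y)%E].

(* prox_{a g}(v) as an argmin set, a singleton for a > 0 and g closed, proper
   and convex. *)
Definition prox (R : realType) (n : nat) (a : R) (g : 'rV[R]_n -> \bar R)
    (v : 'rV[R]_n) : set 'rV[R]_n :=
  [set p | forall y,
    (g p + ((2 * a)^-1 * enorm (p - v) ^+ 2)%:E
      <= g y + ((2 * a)^-1 * enorm (y - v) ^+ 2)%:E)%E].

Definition objective (R : realType) (n : nat) (f : 'rV[R]_n -> R)
    (g : 'rV[R]_n -> \bar R) (x : 'rV[R]_n) : \bar R :=
  ((f x)%:E + g x)%E.

Definition minimizers (R : realType) (n : nat) (F : 'rV[R]_n -> \bar R) :
    set 'rV[R]_n :=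
  [set x | forall y, (F x <= F y)%E].

Definition minval (R : realType) (n : nat) (F : 'rV[R]_n -> \bar R) : \bar R :=
  ereal_inf (range F).

(* F x - F_* as a real number; only used at points x where g has a
   subgradient, so that F x and F_* are finite and [fine] loses nothing. *)
Definition gap (R : realType) (n : nat) (F : 'rV[R]_n -> \bar R)
    (x : 'rV[R]_n) : R :=
  fine (F x - minval F)%E.

Section Quantities.
Context (R : realType) (n : nat).
Implicit Types (f : 'rV[R]_n -> R) (g : 'rV[R]_n -> \bar R).
Implicit Types (x xi : nat -> 'rV[R]_n) (alpha theta : nat -> R).
Implicit Types (xs : 'rV[R]_n) (k : nat).

(* for k >= 1 *)
Definition lambda f x k : R :=
  dot (grad f (x k) - grad f (x k.-1)) (x k - x k.-1)
    / enorm (grad f (x k) - grad f (x k.-1)) ^+ 2.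

(* for k >= 1 *)
Definition stepsize_rule f x alpha theta k : Prop :=
  [/\ alpha k.-1 <= lambda f x k ->
        alpha k = Num.sqrt (1 + theta k.-1) * alpha k.-1 /\
        theta k = alpha k / alpha k.-1,
      alpha k.-1 / 2 < lambda f x k < alpha k.-1 ->
        alpha k = alpha k.-1 / Num.sqrt 2 /\ theta k = 0
    & lambda f x k <= alpha k.-1 / 2 ->
        alpha k = lambda f x k / Num.sqrt 2 /\ theta k = 0].

Record AdaPBB f g x xi alpha theta : Prop := {
  AdaPBB_alpha0 : 0 < alpha 0%N ;
  AdaPBB_theta0 : 0 <= theta 0%N ;
  AdaPBB_step : forall k, (1 <= k)%N -> stepsize_rule f x alpha theta k ;
  AdaPBB_prox : forall k,
    prox (alpha k) g (x k - alpha k *: grad f (x k)) (x k.+1) ;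
  AdaPBB_grad_neq : forall k, (1 <= k)%N -> grad f (x k) <> grad f (x k.-1) ;
  AdaPBB_subgrad : forall k, subdiff g (x k) (xi k) ;
  AdaPBB_xi : forall k,
    x k.+1 = x k - alpha k *: (grad f (x k) + xi k.+1)
}.

(* B_k, for k >= 1. The last branch is meant for 0 < lambda_k; under the
   standing assumptions lambda_k is always positive. *)
Definition Bcoef f x alpha k : R :=
  if alpha k.-1 <= lambda f x k then 0
  else if alpha k.-1 / 2 < lambda f x k then 1
  else (alpha k.-1 - lambda f x k) ^+ 2 / lambda f x k ^+ 2.

Definition Ecoef_pos f x alpha k : R :=
  if alpha k.-1 <= lambda f x k then (alpha k.-1)^-1 else 0.

Definition Ecoef f x alpha k : R :=
  if k == 0%N then
    (Ecoef_pos f x alpha 1 * alpha 1%N ^+ 2 - alpha 0%N) / alpha 0%N ^+ 2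
  else Ecoef_pos f x alpha k.

Definition wcoef f x alpha k : R :=
  alpha k + Ecoef f x alpha k * alpha k ^+ 2
    - Ecoef f x alpha k.+1 * alpha k.+1 ^+ 2.

(* for k >= 1 *)
Definition Useq f g x xi alpha xs k : R :=
  enorm (x k - xs) ^+ 2
  + 2 * Bcoef f x alpha k * alpha k ^+ 2
      * enorm (grad f (x k.-1) + xi k.-1) ^+ 2
  + 2 * Ecoef f x alpha k * alpha k ^+ 2 * gap (objective f g) (x k.-1).

Definition Sseq f x alpha k : R :=
  Ecoef f x alpha 1 * alpha 1%N ^+ 2 + \sum_(1 <= i < k.+1) alpha i.

Definition xbar f x alpha k : 'rV[R]_n :=
  (Sseq f x alpha k)^-1 *:
    ((alpha k * (1 + Ecoef f x alpha k * alpha k)) *: x k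
     + \sum_(1 <= i < k) wcoef f x alpha i *: x i).

Definition Tradius f g x xi alpha xs : R :=
  Num.sqrt (enorm (x 0%N - xs) ^+ 2
    + 2 * alpha 0%N ^+ 2 * enorm (grad f (x 0%N) + xi 0%N) ^+ 2
    + Num.max (2 * (Ecoef f x alpha 1 * alpha 1%N ^+ 2 - alpha 0%N)) 0
        * gap (objective f g) (x 0%N)).

Definition locally_smooth f xs (T : R) : Prop :=
  exists L : R, 0 < L /\
    forall y z, cball xs T y -> cball xs T z ->
      (2 * L)^-1 * enorm (grad f y - grad f z) ^+ 2
        <= f y - f z - dot (grad f z) (y - z).

End Quantities.

(* Main.v *)
Require Import Defs.
From HB Require Import structures.
From mathcomp Require Import all_boot all_order all_algebra.
From mathcomp Require Import all_classical all_reals all_analysis.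
From mathcomp Require Import ring lra.
Import Order.TTheory GRing.Theory Num.Theory.
Import numFieldNormedType.Exports.
Local Open Scope classical_set_scope.
Local Open Scope ring_scope.
Set Implicit Arguments.
Unset Strict Implicit.
Unset Printing Implicit Defensive.

(** Write Fmin for the minimum of F, and [d k] for the vector grad f (x k) + xi k,
    a subgradient of F at [x k].

    The tangent inequality of f at [x k] and the subgradient inequalities of g
    at [x k] and [x k.+1] give
      |x k.+1 - xs|^2 + 2 alpha_k (F (x k) - Fmin)
        <= |x k - xs|^2 + alpha_k^2 |d k|^2          (distance_descent),
    so the whole difficulty is the last term. It is absorbed in two ways. First,
    the factors 1/sqrt 2 of the stepsize rule ensure
    2 B_{k+1} alpha_{k+1}^2 <= alpha_k^2 (Bcoef_alpha_sq_le), so alpha_k^2 |d k|^2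
    also dominates the B-term of U_{k+1}. Second, |d k|^2 is controlled by what
    the previous step has already paid for,
      |d k|^2 <= B_k |d (k-1)|^2 + E_k (F (x (k-1)) - F (x k))
                                                     (residual_bound),
    where the three cases of the rule are exactly the three ways to compare the
    gradient increment with the step through lambda_k. Together these give
    U_{k+1} + 2 w_k (F (x k) - Fmin) <= U_k            (energy_descent).

    The choice theta_k = alpha_k / alpha_{k-1} after an increase keeps the
    weights w_k nonnegative, so U stays below U_1 and telescoping bounds the
    weighted sum of the gaps; the weights add up to S_k, and Jensen's inequality
    transfers the bound to the averaged point.

    For the rate, S_k must grow linearly. Since |x k - xs|^2 <= U_k <= U_1 <= T^2,
    all iterates lie in the ball where f is smooth; there the gradient is
    cocoercive, which means lambda_k >= 1/L, and the stepsize rule then keeps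
    alpha_k away from zero (alpha_lower_bound). *)

(** * The Euclidean inner product and gradients of convex functions *)

Section Euclid.
Context (R : realType) (n : nat).
Implicit Types u v w : 'rV[R]_n.

Lemma dotC u v : dot u v = dot v u.
Proof. by apply: eq_bigr => i _; rewrite mulrC. Qed.

Lemma dotDl u v w : dot (u + v) w = dot u w + dot v w.
Proof. by rewrite -big_split; apply: eq_bigr => i _; rewrite mxE mulrDl. Qed.

Lemma dotZl (c : R) u w : dot (c *: u) w = c * dot u w.
Proof. by rewrite /dot mulr_sumr; apply: eq_bigr => i _; rewrite mxE mulrA. Qed.

Lemma dotNl u w : dot (- u) w = - dot u w.
Proof. by rewrite -scaleN1r dotZl mulN1r. Qed.

Lemma dotDr u v w : dot w (u + v) = dot w u + dot w v.
Proof. by rewrite ![dot w _]dotC dotDl. Qed.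

Lemma dotZr (c : R) u w : dot w (c *: u) = c * dot w u.
Proof. by rewrite ![dot w _]dotC dotZl. Qed.

Lemma dotNr u w : dot w (- u) = - dot w u.
Proof. by rewrite ![dot w _]dotC dotNl. Qed.

Definition dotE := (dotDl, dotDr, dotNl, dotNr, dotZl, dotZr).

Lemma dot_ge0 u : 0 <= dot u u.
Proof. by apply: sumr_ge0 => i _; rewrite -expr2 sqr_ge0. Qed.

Lemma dot_eq0 u : (dot u u == 0) = (u == 0).
Proof.
apply/eqP/eqP => [|->]; last by rewrite /dot big1// => i _; rewrite mxE mul0r.
move/eqP; rewrite psumr_eq0 => [/allP h|i _]; last by rewrite -expr2 sqr_ge0.
apply/rowP => i; rewrite mxE; apply/eqP.
by rewrite -sqrf_eq0 expr2 (implyP (h i _))// mem_index_enum.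
Qed.

Lemma enorm_sq u : enorm u ^+ 2 = dot u u.
Proof. by rewrite sqr_sqrtr// dot_ge0. Qed.

(** [a], [b] are the values and [p], [q] the gradients at [y], [z]: adding the
    smoothness inequality in both orders cancels the values. *)
Lemma cocoercive_of_smooth (L a b : R) (p q y z : 'rV[R]_n) :
  (2 * L)^-1 * enorm (p - q) ^+ 2 <= a - b - dot q (y - z) ->
  (2 * L)^-1 * enorm (q - p) ^+ 2 <= b - a - dot p (z - y) ->
  L^-1 * enorm (p - q) ^+ 2 <= dot (p - q) (y - z).
Proof. by rewrite invfM !enorm_sq !dotE (dotC q p); lra. Qed.

End Euclid.

Section Gradient.
Context (R : realType) (n : nat) (f : 'rV[R]_n -> R).
Hypothesis f_diff : forall y, differentiable f y.
Implicit Types u v x y : 'rV[R]_n.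

Lemma derive_dot_grad x v : 'D_v f x = dot (grad f x) v.
Proof.
rewrite deriveE// [in LHS](row_sum_delta v) linear_sum.
by apply: eq_bigr => i _; rewrite linearZ /= mxE deriveE// mulrC.
Qed.

(** One-sided quotients suffice below, because convexity bounds the increment
    of f only along [0 <= t <= 1]. *)
Lemma right_difference_quotient_cvg x v :
  (t^-1 * (f (x + t *: v) - f x)) @[t --> 0^'+] --> dot (grad f x) v.
Proof.
apply: cvg_dnbhs_at_right; rewrite -derive_dot_grad.
have /cvg_ex[l hl] : derivable f x v by exact: diff_derivable.
rewrite /derive (cvg_lim _ hl)//.
rewrite (_ : (fun t => _) = fun h => h^-1 *: ((f \o shift x) (h *: v) - f x))//.
by apply/funext => t; rewrite /= [_ + x]addrC.
Qed.

(** The quotient along [v] bounds <u, v> by <grad f x, v>; the direction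
    [v = u - grad f x] then leaves a nonpositive square. *)
Lemma subgradient_eq_grad x u :
  (forall y, f x + dot u (y - x) <= f y) -> u = grad f x.
Proof.
move=> hu.
have le_dot v : dot u v <= dot (grad f x) v.
  apply: (cvgr_to_ge (@right_difference_quotient_cvg x v)).
  near=> t; have t0 : 0 < t by near: t; exact: nbhs_right_gt.
  rewrite mulrC ler_pdivlMr// mulrC -dotZr lerBrDl.
  by have := hu (x + t *: v); rewrite addrAC subrr add0r.
apply/eqP; rewrite -subr_eq0 -dot_eq0; apply/eqP/le_anti.
rewrite dot_ge0 andbT dotDl dotNl subr_le0; exact: le_dot.
Unshelve. all: by end_near. Qed.

Hypothesis f_convex : convex_function [set: convex_lmodType 'rV[R]_n] f.

Lemma convex_functionE x y (t : R) : 0 <= t -> t <= 1 ->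
  f (t *: x + (1 - t) *: y) <= t * f x + (1 - t) * f y.
Proof.
move=> t0 t1; have t01 : 0 <= t <= 1 by rewrite t0.
have := f_convex (Itv01 t0 t1) (x := x) (y := y); rewrite !inE.
by move=> /(_ Logic.I Logic.I).
Qed.

Lemma convex_above_tangent x y : f x + dot (grad f x) (y - x) <= f y.
Proof.
rewrite -lerBrDl.
apply: (cvgr_to_le (@right_difference_quotient_cvg x (y - x))).
near=> t; have t0 : 0 < t by near: t; exact: nbhs_right_gt.
have t1 : t <= 1 by near: t; exact: nbhs_right_le.
rewrite mulrC ler_pdivrMr//.
have := convex_functionE y x (ltW t0) t1.
have -> : t *: y + (1 - t) *: x = x + t *: (y - x).
  by rewrite scalerBl scale1r scalerBr addrCA.
by lra.
Unshelve. all: by end_near. Qed.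

(** If the pairing vanished, both tangent inequalities between [x] and [y]
    would be equalities, so the tangent of f at [y] would also support f at
    [x], and uniqueness of the subgradient would equate the two gradients. This
    is what makes lambda_k positive. *)
Lemma grad_monotone_gt0 x y : grad f x <> grad f y ->
  0 < dot (grad f x - grad f y) (x - y).
Proof.
move=> nxy; rewrite ltNge; apply/negP => h; apply: nxy; symmetry.
apply: subgradient_eq_grad => z.
have h1 := convex_above_tangent y x; have h2 := convex_above_tangent x y.
have := convex_above_tangent y z.
move: h h1 h2; move: (grad f x) (grad f y) => p q.
by rewrite !dotE; lra.
Qed.

End Gradient.

(** * Convexity and subgradients of extended-valued functions *)

Section ConvexExtended.
Context (R : realType) (n : nat).
Implicit Types (g h : 'rV[R]_n -> \bar R) (x y u : 'rV[R]_n).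

(** Convexity of the epigraph: phrased with real upper bounds, it never meets
    sums or products of infinite values. *)
Definition epi_convex h :=
  forall x y (r s t : R), 0 <= t -> t <= 1 ->
    (h x <= r%:E)%E -> (h y <= s%:E)%E ->
    (h (t *: x + (1 - t) *: y)%R <= (t * r + (1 - t) * s)%:E)%E.

Lemma objective_epi_convex (f : 'rV[R]_n -> R) g :
  convex_function [set: convex_lmodType 'rV[R]_n] f ->
  convex_efun g -> proper_fun g -> epi_convex (objective f g).
Proof.
move=> fC gC [gN _] x y r s t t0 t1; rewrite /objective.
have := gC x y t t0 t1; have := convex_functionE fC x y t0 t1.
move: (gN x) (gN y) (gN (t *: x + (1 - t) *: y)).
case: (g x) => [a| |] //; case: (g y) => [b| |] //.
case: (g (t *: x + (1 - t) *: y)) => [c| |] // _ _ _.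
rewrite !lee_fin => hf hg hr hs.
have := ler_wpM2l t0 hr; have : 0 <= 1 - t by rewrite subr_ge0.
move=> /ler_wpM2l/(_ _ _ hs); lra.
Qed.

(** The weights of the averaged point may vanish, so Jensen's inequality only
    asks for a positive total. *)
Lemma epi_convex_jensen h (I : eqType) (l : seq I) (w r : I -> R)
    (z : I -> 'rV[R]_n) :
  epi_convex h -> (forall i, 0 <= w i) -> (forall i, (h (z i) <= (r i)%:E)%E) ->
  0 < \sum_(i <- l) w i ->
  (h ((\sum_(i <- l) w i)^-1 *: \sum_(i <- l) w i *: z i)%R
    <= ((\sum_(i <- l) w i)^-1 * \sum_(i <- l) w i * r i)%:E)%E.
Proof.
move=> hC w0 hz; elim: l => [|a l IH]; rewrite ?big_nil ?ltxx// !big_cons => W0.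
have : 0 <= \sum_(i <- l) w i by exact: sumr_ge0.
(* a tail of total weight zero contributes nothing to either side *)
rewrite le_eqVlt => /orP[|Wl].
  rewrite eq_sym psumr_eq0// => /allP w_eq0.
  have wl0 i : i \in l -> w i = 0 by move=> /w_eq0 /eqP.
  move: W0; rewrite big_seq_cond !(@big1_seq _ _ _ _ l) => [|i|i|i].
  - by rewrite !addr0 => W0; rewrite scalerA mulrA mulVf ?gt_eqF// scale1r mul1r.
  - by move=> /= /wl0 ->; rewrite mul0r.
  - by move=> /= /wl0 ->; rewrite scale0r.
  - by move=> /= /andP[_ /wl0].
set W := \sum_(i <- l) w i in IH W0 Wl *.
set Z := \sum_(i <- l) w i *: z i in IH *.
set S := \sum_(i <- l) w i * r i in IH *.
(* otherwise combine [z a] with the normalized average of the tail *)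
have Wn : w a + W != 0 by rewrite gt_eqF.
have t1 : w a / (w a + W) <= 1 by rewrite ler_pdivrMr// mul1r lerDl ltW.
have := hC (z a) (W^-1 *: Z) _ _ _ (divr_ge0 (w0 a) (ltW W0)) t1 (hz a) (IH Wl).
have onem_t : 1 - w a / (w a + W) = W / (w a + W) by field.
rewrite onem_t; congr (h _ <= _)%E.
  rewrite scalerDr !scalerA; congr (_ *: _ + _ *: _); first by rewrite mulrC.
  by field; rewrite Wn gt_eqF.
by congr _%:E; field; rewrite Wn gt_eqF.
Qed.

(** A subgradient at a point of infinite value would force g = +oo everywhere. *)
Lemma subdiff_fin_num g x u : proper_fun g -> subdiff g x u -> g x \is a fin_num.
Proof.
move=> [gN [y gy]] /(_ y); move: (gN x) gy.
by case: (g x) => // _ /lt_geF; rewrite addye// => ->.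
Qed.

Lemma subdiff_fine g x y u : subdiff g x u ->
  g x \is a fin_num -> g y \is a fin_num ->
  fine (g x) + dot u (y - x) <= fine (g y).
Proof. by move=> /(_ y); case: (g x) => // a; case: (g y). Qed.

End ConvexExtended.

(** * Positivity of the stepsizes and signs of the coefficients *)

Section Algorithm.
Context (R : realType) (n : nat) (f : 'rV[R]_n -> R) (g : 'rV[R]_n -> \bar R).
Context (xs : 'rV[R]_n) (x xi : nat -> 'rV[R]_n) (alpha theta : nat -> R).
Hypothesis f_convex : convex_function [set: convex_lmodType 'rV[R]_n] f.
Hypothesis f_diff : forall y, differentiable f y.
Hypothesis g_proper : proper_fun g.
Hypothesis g_convex : convex_efun g.
Hypothesis xs_min : minimizers (objective f g) xs.
Hypothesis algo : AdaPBB f g x xi alpha theta.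

Local Notation F := (objective f g).
Local Notation G k := (grad f (x k)).
Local Notation gp k := (gap F (x k)).
Local Notation lam := (lambda f x).
Local Notation B := (Bcoef f x alpha).
Local Notation E := (Ecoef f x alpha).
Local Notation w := (wcoef f x alpha).
Local Notation S := (Sseq f x alpha).
Local Notation U := (Useq f g x xi alpha xs).
Local Notation d k := (G k + xi k).

Lemma minval_minimizer : minval F = F xs.
Proof.
apply/le_anti/andP; split; first by apply: ereal_inf_lbound; exists xs.
by apply: le_ereal_inf_tmp => _ [y _ <-]; exact: xs_min.
Qed.

Lemma g_iterate_fin_num k : g (x k) \is a fin_num.
Proof. exact: subdiff_fin_num g_proper (AdaPBB_subgrad algo k). Qed.

Lemma g_minimizer_fin_num : g xs \is a fin_num.
Proof.
have := xs_min (x 0%N); rewrite /objective; case: g_proper => gN _.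
move: (gN xs) (g_iterate_fin_num 0).
by case: (g xs) => // _; case: (g (x 0%N)).
Qed.

Lemma gapE k : gp k = f (x k) + fine (g (x k)) - (f xs + fine (g xs)).
Proof.
rewrite /gap minval_minimizer /objective.
by move: (g_iterate_fin_num k) g_minimizer_fin_num; case: (g (x k)); case: (g xs).
Qed.

Lemma gap_ge0 k : 0 <= gp k.
Proof.
rewrite gapE; have := xs_min (x k); rewrite /objective.
move: (g_iterate_fin_num k) g_minimizer_fin_num.
by case: (g (x k)); case: (g xs) => //= a b _ _; rewrite lee_fin; lra.
Qed.

Lemma objective_minimizer : F xs = (f xs + fine (g xs))%:E.
Proof. by rewrite /objective EFinD fineK// g_minimizer_fin_num. Qed.

Lemma objective_iterate k : F (x k) = (f xs + fine (g xs) + gp k)%:E.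
Proof.
rewrite gapE addrC subrK /objective EFinD fineK//; exact: g_iterate_fin_num.
Qed.

Lemma grad_diff_sq_gt0 k : 0 < enorm (G k.+1 - G k) ^+ 2.
Proof.
have neq := AdaPBB_grad_neq algo (isT : (1 <= k.+1)%N).
rewrite enorm_sq lt_neqAle dot_ge0 andbT eq_sym dot_eq0 subr_eq0.
exact/eqP.
Qed.

Lemma lambda_gt0 k : 0 < lam k.+1.
Proof.
apply: divr_gt0 (grad_diff_sq_gt0 k).
exact: grad_monotone_gt0 (AdaPBB_grad_neq algo (isT : (1 <= k.+1)%N)).
Qed.

Lemma stepsize_cases k : 0 < alpha k ->
  [\/ [/\ alpha k <= lam k.+1, alpha k.+1 = Num.sqrt (1 + theta k) * alpha k,
          theta k.+1 = alpha k.+1 / alpha k, B k.+1 = 0 & E k.+1 = (alpha k)^-1],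
      [/\ alpha k / 2 < lam k.+1 < alpha k, alpha k.+1 = alpha k / Num.sqrt 2,
          theta k.+1 = 0, B k.+1 = 1 & E k.+1 = 0]
    | [/\ lam k.+1 <= alpha k / 2, alpha k.+1 = lam k.+1 / Num.sqrt 2,
          theta k.+1 = 0, B k.+1 = (alpha k - lam k.+1) ^+ 2 / lam k.+1 ^+ 2
        & E k.+1 = 0]].
Proof.
move=> ak; have [/= s1 s2 s3] := AdaPBB_step algo (isT : (1 <= k.+1)%N).
rewrite /Bcoef /Ecoef /Ecoef_pos /=.
have [h1|h1] := leP (alpha k) (lam k.+1).
  by have [? ?] := s1 h1; constructor 1.
have [h2|h2] := ltP (alpha k / 2) (lam k.+1).
  by have [|? ?] := s2; rewrite ?h2// ; constructor 2; split => //; rewrite h2.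
by have [? ?] := s3 h2; constructor 3.
Qed.

(** Proved together because the increase of alpha involves sqrt (1 + theta). *)
Lemma alpha_gt0_theta_ge0 k : 0 < alpha k /\ 0 <= theta k.
Proof.
elim: k => [|k [ak tk]]; first by split; case: algo.
have s2 : 0 < Num.sqrt 2 :> R by rewrite sqrtr_gt0.
case: (stepsize_cases ak) => -[_ -> -> _ _].
- have a1 : 0 < Num.sqrt (1 + theta k) * alpha k.
    by rewrite mulr_gt0// sqrtr_gt0 ltr_wpDr.
  by split => //; exact: divr_ge0 (ltW a1) (ltW ak).
- by rewrite divr_gt0.
- by rewrite divr_gt0// lambda_gt0.
Qed.

Lemma alpha_gt0 k : 0 < alpha k.
Proof. by case: (alpha_gt0_theta_ge0 k). Qed.

Lemma theta_ge0 k : 0 <= theta k.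
Proof. by case: (alpha_gt0_theta_ge0 k). Qed.

Lemma Ecoef_ge0 k : 0 <= E k.+1.
Proof.
case: (stepsize_cases (alpha_gt0 k)) => -[_ _ _ _ ->] //.
by rewrite invr_ge0 ltW// alpha_gt0.
Qed.

(** Together with [Ecoef_alpha_theta] this expresses E alpha^2 through the
    quantities of either step it joins; comparing the
    two forms gives the sign of w_k. *)
Lemma Ecoef_alpha_sq k :
  E k.+1 * alpha k.+1 ^+ 2 = (1 + theta k) * alpha k \/ E k.+1 = 0.
Proof.
have a0 := alpha_gt0 k; have t0 := theta_ge0 k.
case: (stepsize_cases a0) => -[_ -> _ _ ->]; [left|by right|by right].
by rewrite exprMn sqr_sqrtr ?addr_ge0//; field; rewrite gt_eqF.
Qed.

Lemma Ecoef_alpha_theta k : E k.+1 * alpha k.+1 ^+ 2 = theta k.+1 * alpha k.+1.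
Proof.
by case: (stepsize_cases (alpha_gt0 k)) => -[_ _ -> _ ->]; ring.
Qed.

(** If the step increases at k + 1, then for k >= 1
    E_{k+1} alpha_{k+1}^2 = (1 + theta_k) alpha_k is exactly
    alpha_k + E_k alpha_k^2, so w_k = 0; otherwise E_{k+1} = 0. The value of E_0
    is chosen to make w_0 = 0. *)
Lemma wcoef_ge0 k : 0 <= w k.
Proof.
have a0 := alpha_gt0 k.
rewrite /wcoef; case: k a0 => [|k] a0.
  by rewrite /Ecoef /= divfK ?gt_eqF ?exprn_gt0//; lra.
rewrite Ecoef_alpha_theta.
case: (Ecoef_alpha_sq k.+1) => ->; first lra.
by rewrite mul0r subr0 addr_ge0// ?mulr_ge0 ?theta_ge0// ltW.
Qed.

Lemma Bcoef_ge0 k : 0 <= B k.+1.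
Proof.
case: (stepsize_cases (alpha_gt0 k)) => -[_ _ _ -> _] //.
by rewrite divr_ge0// sqr_ge0.
Qed.

(** This is where the factors 1/sqrt 2 are spent: the left-hand side is 0,
    alpha_k^2 and (alpha_k - lambda_{k+1})^2 in the three cases. *)
Lemma Bcoef_alpha_sq_le k : 2 * (B k.+1 * alpha k.+1 ^+ 2) <= alpha k ^+ 2.
Proof.
have a0 := alpha_gt0 k; have l0 := lambda_gt0 k.
have sq2 (c : R) : (c / Num.sqrt 2) ^+ 2 = c ^+ 2 / 2.
  by rewrite expr_div_n sqr_sqrtr.
case: (stepsize_cases a0) => -[hl -> _ -> _].
- by rewrite mul0r mulr0 sqr_ge0.
- by rewrite sq2; lra.
- rewrite sq2.
  rewrite (_ : 2 * _ = (alpha k - lam k.+1) ^+ 2); first nra.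
  by field; rewrite gt_eqF.
Qed.

(** * The energy inequality *)

Lemma iterate_diff k : x k.+1 - x k = - (alpha k *: (G k + xi k.+1)).
Proof. by rewrite (AdaPBB_xi algo) addrAC subrr add0r. Qed.

(** Expand the square around [xs] and bound the linear term by the tangent
    inequality at [x k] and the subgradient inequalities of g. Changing xi k.+1
    into xi k costs alpha_k^2 |xi k - xi k.+1|^2, which has the favourable sign. *)
Lemma distance_descent k :
  enorm (x k.+1 - xs) ^+ 2 + 2 * alpha k * gp k
    <= enorm (x k - xs) ^+ 2 + alpha k ^+ 2 * enorm (d k) ^+ 2.
Proof.
have a0 := alpha_gt0 k; have iter := iterate_diff k.
have h1 := convex_above_tangent f_diff f_convex (x k) xs.
have h2 := subdiff_fine (AdaPBB_subgrad algo k.+1) (g_iterate_fin_num k.+1)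
  g_minimizer_fin_num.
have h3 := subdiff_fine (AdaPBB_subgrad algo k) (g_iterate_fin_num k)
  (g_iterate_fin_num k.+1).
rewrite gapE !enorm_sq.
have e1 : xs - x k = - (x k - xs) by rewrite opprB.
have e2 : x k.+1 - xs = (x k - xs) - alpha k *: (G k + xi k.+1).
  by rewrite -iter [RHS]addrC addrA subrK.
have e3 : xs - x k.+1 = - ((x k - xs) - alpha k *: (G k + xi k.+1)).
  by rewrite -e2 opprB.
rewrite e1 in h1; rewrite e3 in h2; rewrite iter in h3; rewrite e2.
move: h1 h2 h3.
move: (x k - xs) (G k) (xi k) (xi k.+1) => a b c c' h1 h2 h3.
have q := mulr_ge0 (sqr_ge0 (alpha k)) (dot_ge0 (c - c')).
(* the three inequalities are added and scaled by the stepsize *)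
have := mulr_ge0 (ltW a0) (addr_ge0 (addr_ge0 _ _) _).
move: (h1) (h2) (h3); rewrite -subr_ge0 => h1'.
rewrite -subr_ge0 => h2'; rewrite -subr_ge0 => h3'.
move=> /(_ _ _ _ h1' h2' h3').
move: q; rewrite !dotE (dotC b a) (dotC c' a) (dotC c' b) (dotC c' c) (dotC b c).
lra.
Qed.

(** Let p = (x k - x k.+1) / alpha_k and D the gradient increment, so that
    d k.+1 = p + D and lambda |D|^2 = - alpha_k <p, D>. For lambda >= alpha_k,
    <p + D, D> <= 0, whence |p + D|^2 <= <p + D, p>, and convexity of F bounds
    alpha_k <p + D, p> by the decrease of F. For smaller lambda, the expansion
    |p + D|^2 = |p|^2 + (1 - 2 lambda / alpha_k) |D|^2 gives at most |p|^2 when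
    lambda > alpha_k / 2, and at most |p|^2 (alpha_k / lambda - 1)^2 otherwise,
    by lambda |D| <= alpha_k |p|; finally |p| <= |d k| by monotonicity of the
    subdifferential of g. *)
Lemma residual_bound k :
  enorm (d k.+1) ^+ 2 <= B k.+1 * enorm (d k) ^+ 2 + E k.+1 * (gp k - gp k.+1).
Proof.
have a0 := alpha_gt0 k; have l0 := lambda_gt0 k; have iter := iterate_diff k.
have D0 := grad_diff_sq_gt0 k; rewrite enorm_sq in D0.
(* the defining property of the Barzilai-Borwein quotient, without division *)
have lamE : lam k.+1 * dot (G k.+1 - G k) (G k.+1 - G k)
    = - (alpha k * dot (G k.+1 - G k) (G k + xi k.+1)).
  by rewrite /lambda /= enorm_sq divfK ?gt_eqF// iter dotNr dotZr.
have h1 := convex_above_tangent f_diff f_convex (x k.+1) (x k).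
have h2 := subdiff_fine (AdaPBB_subgrad algo k.+1) (g_iterate_fin_num k.+1)
  (g_iterate_fin_num k).
have h3 := subdiff_fine (AdaPBB_subgrad algo k) (g_iterate_fin_num k)
  (g_iterate_fin_num k.+1).
have iter' : x k - x k.+1 = alpha k *: (G k + xi k.+1).
  by rewrite -[LHS]opprB iter opprK.
rewrite !enorm_sq !gapE.
rewrite iter' in h1 h2; rewrite iter in h3.
have e1 : d k.+1 = (G k + xi k.+1) + (G k.+1 - G k).
  by rewrite [RHS]addrC addrA subrK.
have e0 : d k = (G k + xi k.+1) + (xi k - xi k.+1).
  by rewrite -addrA [xi k.+1 + _]addrC subrK.
(* monotonicity of the subdifferential of g along the step *)
have hN : dot (G k + xi k.+1) (G k + xi k.+1) <= dot (d k) (d k).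
  have : 0 <= alpha k * dot (xi k - xi k.+1) (G k + xi k.+1).
    by move: h2 h3; rewrite !(dotNr, dotZr) dotDl dotNl; lra.
  rewrite pmulr_rge0// e0.
  move: (G k + xi k.+1) (xi k - xi k.+1) => p c h.
  by have := dot_ge0 c; rewrite !dotE (dotC p c); lra.
have hF : alpha k * dot (d k.+1) (G k + xi k.+1)
    <= f (x k) + fine (g (x k)) - (f (x k.+1) + fine (g (x k.+1))).
  by move: h1 h2; rewrite !dotZr !dotDl; lra.
have -> : f (x k) + fine (g (x k)) - (f xs + fine (g xs))
  - (f (x k.+1) + fine (g (x k.+1)) - (f xs + fine (g xs)))
  = f (x k) + fine (g (x k)) - (f (x k.+1) + fine (g (x k.+1))) by ring.
move: hN hF D0 lamE; rewrite e1.
move: (f (x k) + _ - _) (dot (d k) (d k)) => M N.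
move: (G k + xi k.+1) (G k.+1 - G k) => p D.
(* this square, nonnegative, is the bound lambda |D| <= alpha |p| *)
have := dot_ge0 (alpha k *: p + lam k.+1 *: D).
rewrite !dotE (dotC p D).
move: (dot p p) (dot D p) (dot D D) => P q Q.
case: (stepsize_cases a0) => -[hl _ _ -> ->];
  move: (alpha k) (lam k.+1) a0 l0 hl => a l a0 l0 hl hC hN hF Q0 lQ.
- rewrite mul0r add0r mulrC ler_pdivlMr//; nra.
- by rewrite mul1r mul0r addr0; nra.
- rewrite mul0r addr0 mulrAC ler_pdivlMr ?exprn_gt0//.
  have lq : a * l * q = - (l ^+ 2 * Q).
    by rewrite -mulrA mulrCA -[a * q]opprK -lQ; ring.
  have k0 : 0 <= a ^+ 2 * P - l ^+ 2 * Q by lra.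
  have k1 : 0 <= (a - 2 * l) * (a ^+ 2 * P - l ^+ 2 * Q) by apply: mulr_ge0; lra.
  have k2 : 0 <= (a - l) ^+ 2 * (a * (N - P)).
    by rewrite mulr_ge0 ?sqr_ge0// mulr_ge0 ?subr_ge0// ltW.
  have k3 : l * (a * l * q) = - (l * (l ^+ 2 * Q)) by rewrite lq mulrN.
  rewrite -(ler_pM2l a0); lra.
Qed.

Lemma energy_descent k : U k.+2 + 2 * (w k.+1 * gp k.+1) <= U k.+1.
Proof.
have dd := distance_descent k.+1.
have := ler_wpM2r (sqr_ge0 (enorm (d k.+1))) (Bcoef_alpha_sq_le k.+1).
have := ler_wpM2l (sqr_ge0 (alpha k.+1)) (residual_bound k).
move: dd; rewrite /Useq /wcoef [k.+2.-1]/= [k.+1.-1]/=.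
move: (enorm (x k.+2 - xs) ^+ 2) (enorm (x k.+1 - xs) ^+ 2) => X2 X1.
move: (enorm (d k.+1) ^+ 2) (enorm (d k) ^+ 2) (gp k.+1) (gp k) => D1 D0 p1 p0.
move: (B k.+2) (B k.+1) (E k.+2) (E k.+1) => B2 B1 E2 E1.
by move: (alpha k.+2) (alpha k.+1) => a2 a1; lra.
Qed.

Lemma energy_sum k : U k.+1 + 2 * (\sum_(1 <= i < k.+1) w i * gp i) <= U 1.
Proof.
elim: k => [|k IH]; first by rewrite big_geq// mulr0 addr0.
by rewrite big_nat_recr//=; have := energy_descent k; move: IH; lra.
Qed.

Lemma Useq_ge k :
  enorm (x k.+1 - xs) ^+ 2 + 2 * (E k.+1 * alpha k.+1 ^+ 2 * gp k) <= U k.+1.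
Proof.
have := mulr_ge0 (mulr_ge0 (Bcoef_ge0 k) (sqr_ge0 (alpha k.+1)))
  (sqr_ge0 (enorm (d k))).
rewrite /Useq [k.+1.-1]/=.
move: (enorm (x k.+1 - xs) ^+ 2) (enorm (d k) ^+ 2) (gp k) => X D p.
by move: (B k.+1) (E k.+1) (alpha k.+1) => b e a; lra.
Qed.

Lemma Ecoef_gap_ge0 k : 0 <= E k.+1 * alpha k.+1 ^+ 2 * gp k.
Proof. by rewrite mulr_ge0 ?gap_ge0// mulr_ge0 ?Ecoef_ge0 ?sqr_ge0. Qed.

Lemma Useq1_ge0 : 0 <= U 1.
Proof.
have := Useq_ge 0; have := Ecoef_gap_ge0 0.
by have := sqr_ge0 (enorm (x 1 - xs)); lra.
Qed.

(** * Boundedness of the iterates and of the stepsizes *)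

Lemma Tradius_sq :
  Tradius f g x xi alpha xs ^+ 2 = enorm (x 0 - xs) ^+ 2
    + 2 * alpha 0 ^+ 2 * enorm (d 0) ^+ 2
    + Num.max (2 * (E 1 * alpha 1 ^+ 2 - alpha 0)) 0 * gp 0.
Proof.
rewrite sqr_sqrtr// addr_ge0 ?addr_ge0 ?sqr_ge0//.
  by rewrite mulr_ge0 ?sqr_ge0// mulr_ge0 ?sqr_ge0.
by rewrite mulr_ge0 ?gap_ge0// le_max lexx orbT.
Qed.

(** The first step is the descent inequality at k = 0, where the term
    -2 alpha_0 (F (x 0) - Fmin) is kept and merged with the E-term of U_1; taking
    the maximum with 0 in T only enlarges the bound. *)
Lemma Useq1_le_Tradius : U 1 <= Tradius f g x xi alpha xs ^+ 2.
Proof.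
have Y := sqr_ge0 (enorm (d 0)).
have dd := distance_descent 0.
have := ler_wpM2r Y (Bcoef_alpha_sq_le 0).
have : 2 * (E 1 * alpha 1 ^+ 2 - alpha 0) * gp 0
    <= Num.max (2 * (E 1 * alpha 1 ^+ 2 - alpha 0)) 0 * gp 0.
  by rewrite ler_wpM2r ?gap_ge0// le_max lexx.
rewrite Tradius_sq /Useq [1.-1]/=; move: (Num.max _ _) => m; move: Y dd.
move: (enorm (x 1 - xs) ^+ 2) (enorm (x 0 - xs) ^+ 2) => X1 X0.
move: (enorm (d 0) ^+ 2) (gp 0) => D p.
by move: (B 1) (E 1) (alpha 1) (alpha 0) => b e a1 a0; lra.
Qed.

Lemma iterate_in_ball k : cball xs (Tradius f g x xi alpha xs) (x k).
Proof.
rewrite /cball /= -ler_sqr ?nnegrE ?sqrtr_ge0//; case: k => [|k].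
  rewrite Tradius_sq -addrA lerDl addr_ge0//.
    by rewrite mulr_ge0 ?sqr_ge0// mulr_ge0 ?sqr_ge0.
  by rewrite mulr_ge0 ?gap_ge0// le_max lexx orbT.
apply: le_trans Useq1_le_Tradius; apply: le_trans (energy_sum k).
have := Useq_ge k; have := Ecoef_gap_ge0 k.
have : 0 <= \sum_(1 <= i < k.+1) w i * gp i.
  by apply: sumr_ge0 => i _; rewrite mulr_ge0 ?wcoef_ge0 ?gap_ge0.
move: (U k.+1) (enorm _ ^+ 2) (E _ * _ * _) (\sum_(1 <= i < k.+1) _) => u e p s.
lra.
Qed.

(** On the ball, lambda_k >= 1/L, so a decrease never goes below
    1 / (sqrt 2 L); the witness uses 1 / (2 L), avoiding the square root. *)
Lemma alpha_lower_bound : locally_smooth f xs (Tradius f g x xi alpha xs) ->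
  exists2 c, 0 < c & forall k, c <= alpha k.
Proof.
move=> [L [L0 smooth]].
have lamL k : L^-1 <= lam k.+1.
  rewrite /lambda /= ler_pdivlMr ?grad_diff_sq_gt0//.
  exact: (cocoercive_of_smooth
    (smooth _ _ (iterate_in_ball k.+1) (iterate_in_ball k))
    (smooth _ _ (iterate_in_ball k) (iterate_in_ball k.+1))).
have sq2 (c : R) : 0 <= c -> c / 2 <= c / Num.sqrt 2.
  move=> c0; rewrite ler_wpM2l// lef_pV2 ?posrE ?sqrtr_gt0//.
  by rewrite -ler_sqr ?nnegrE ?sqrtr_ge0// sqr_sqrtr//; lra.
exists (Num.min (alpha 0) (L^-1 / 2)).
  by rewrite lt_min alpha_gt0 divr_gt0 ?invr_gt0.
elim=> [|k IH]; first by rewrite ge_min lexx.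
have L1 : L^-1 / 2 <= L^-1 / Num.sqrt 2 by rewrite sq2// invr_ge0 ltW.
have a0 := alpha_gt0 k.
case: (stepsize_cases a0) => -[hl -> _ _ _].
- apply: le_trans IH _; rewrite ler_peMl ?(ltW a0)//.
  by rewrite -{1}sqrtr1 ler_sqrt; have := theta_ge0 k; lra.
- rewrite ge_min; apply/orP; right; apply: le_trans L1 _.
  rewrite ler_wpM2r ?invr_ge0 ?sqrtr_ge0//; apply: le_trans (lamL k) _.
  by case/andP: hl => _ /ltW.
- rewrite ge_min; apply/orP; right; apply: le_trans L1 _.
  by rewrite ler_wpM2r ?invr_ge0 ?sqrtr_ge0.
Qed.

(** * The averaged point *)

(** The weights of [xbar] in one indexed family. The last one is w_k augmented by
    E_{k+1} alpha_{k+1}^2, the coefficient of the gap of [x k] hidden in U_{k+1}. *)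
Definition avg_weight k i :=
  if i == k then alpha k * (1 + E k * alpha k) else w i.

Lemma sum_avg_weight (V : lmodType R) (z : nat -> V) k : (1 <= k)%N ->
  \sum_(1 <= i < k.+1) avg_weight k i *: z i
    = (alpha k * (1 + E k * alpha k)) *: z k + \sum_(1 <= i < k) w i *: z i.
Proof.
move=> k1; rewrite big_nat_recr//= {2}/avg_weight eqxx addrC; congr (_ + _).
by apply: eq_big_nat => i /andP[_ ik]; rewrite /avg_weight ltn_eqF.
Qed.

(** The E-terms telescope. *)
Lemma sum_wcoef k : \sum_(1 <= i < k.+1) w i = S k - E k.+1 * alpha k.+1 ^+ 2.
Proof.
elim: k => [|k IH]; first by rewrite /Sseq !big_geq//; ring.
rewrite big_nat_recr//= IH /Sseq [in RHS]big_nat_recr//= /wcoef; ring.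
Qed.

Lemma sum_avg_weight_Sseq k : \sum_(1 <= i < k.+2) avg_weight k.+1 i = S k.+1.
Proof.
(* scalars seen as vectors: the weights are averaged against the constant 1 *)
have := sum_avg_weight (fun=> 1 : R^o) (isT : (1 <= k.+1)%N).
under eq_bigr do rewrite /GRing.scale /= mulr1.
move=> ->; under eq_bigr do rewrite /GRing.scale /= mulr1.
rewrite sum_wcoef /Sseq [in RHS]big_nat_recr//= /GRing.scale /=; ring.
Qed.

Lemma Sseq_ge (c : R) k : (forall i, c <= alpha i) -> k%:R * c <= S k.
Proof.
move=> hc; rewrite /Sseq; apply: ler_wpDl.
  by rewrite mulr_ge0 ?Ecoef_ge0 ?sqr_ge0.
rewrite mulr_natl (_ : c *+ k = \sum_(1 <= i < k.+1) c).
  by apply: ler_sum => i _; exact: hc.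
by rewrite sumr_const_nat subn1.
Qed.

Lemma Sseq_gt0 k : 0 < S k.+1.
Proof.
rewrite /Sseq; apply: ltr_wpDl; first by rewrite mulr_ge0 ?Ecoef_ge0 ?sqr_ge0.
rewrite big_nat_recr//=; apply: ltr_wpDl; last exact: alpha_gt0.
by apply: sumr_ge0 => i _; rewrite ltW// alpha_gt0.
Qed.

Lemma avg_weight_ge0 k i : 0 <= avg_weight k.+1 i.
Proof.
rewrite /avg_weight; case: eqP => _; last exact: wcoef_ge0.
have a0 := ltW (alpha_gt0 k.+1).
by rewrite mulr_ge0// addr_ge0// mulr_ge0// Ecoef_ge0.
Qed.

(** The E-term of U_{k+2} is kept on the left of the telescoped inequality: it
    completes w_{k+1} to the last weight of the average. *)
Lemma avg_gap_le k :
  (S k.+1)^-1 * (\sum_(1 <= i < k.+2) avg_weight k.+1 i * gp i)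
    <= U 1 / (2 * S k.+1).
Proof.
have S0 := Sseq_gt0 k.
rewrite invfM mulrA mulrC ler_wpM2r ?invr_ge0 ?(ltW S0)//.
have := sum_avg_weight (fun i => gp i : R^o) (isT : (1 <= k.+1)%N).
rewrite /GRing.scale /= => ->.
have := energy_sum k.+1; have := Useq_ge k.+1.
rewrite big_nat_recr//= [w k.+1]/wcoef.
have := sqr_ge0 (enorm (x k.+2 - xs)).
move: (U k.+2) (U 1) (enorm _ ^+ 2) (\sum_(1 <= i < k.+1) _) => u2 u1 X W.
move: (gp k.+1) (E k.+2) (E k.+1) (alpha k.+2) (alpha k.+1) => p e2 e1 a2 a1.
lra.
Qed.

Lemma objective_xbar_le k :
  (F (xbar f x alpha k.+1) - minval F <= (U 1 / (2 * S k.+1))%:E)%E.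
Proof.
have Fconv := objective_epi_convex f_convex g_convex g_proper.
have S0 := Sseq_gt0 k; have Sn : S k.+1 != 0 by rewrite gt_eqF.
have := @epi_convex_jensen _ _ F nat (index_iota 1 k.+2) (avg_weight k.+1)
  (fun i => f xs + fine (g xs) + gp i) x Fconv (@avg_weight_ge0 k).
rewrite sum_avg_weight_Sseq sum_avg_weight// => jensen.
rewrite minval_minimizer objective_minimizer leeBlDr// -EFinD.
apply: le_trans (jensen _ S0) _; first by move=> i; rewrite objective_iterate.
rewrite lee_fin; under eq_bigr do rewrite mulrDr.
rewrite big_split /= -mulr_suml sum_avg_weight_Sseq mulrDr mulrA mulVf// mul1r.
by rewrite addrC lerD2r avg_gap_le.
Qed.

End Algorithm.

Theorem theorem5p3 (R : realType) (n : nat)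
    (f : 'rV[R]_n -> R) (g : 'rV[R]_n -> \bar R)
    (xs : 'rV[R]_n)
    (x xi : nat -> 'rV[R]_n) (alpha theta : nat -> R)
    (f_convex : convex_function [set: convex_lmodType 'rV[R]_n] f)
    (f_diff : forall y, differentiable f y)
    (f_grad : locally_lipschitz (grad f))
    (g_closed : closed_fun g)
    (g_proper : proper_fun g)
    (g_convex : convex_efun g)
    (xs_min : minimizers (objective f g) xs)
    (algo : AdaPBB f g x xi alpha theta)
    (f_smooth : locally_smooth f xs (Tradius f g x xi alpha xs)) :
  (forall k : nat, (1 <= k)%N ->
    (objective f g (xbar f x alpha k) - minval (objective f g)
      <= (Useq f g x xi alpha xs 1 / (2 * Sseq f x alpha k))%:E)%E)
  /\ (fun k : nat => Useq f g x xi alpha xs 1 / (2 * Sseq f x alpha k) : R^o)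
       =O_\oo (fun k : nat => (k%:R)^-1 : R^o).
Proof.
split.
  case=> // k _.
  exact: (objective_xbar_le f_convex f_diff g_proper g_convex xs_min algo).
have U0 := Useq1_ge0 f_convex f_diff g_proper xs_min algo.
have [c c0 hc] := alpha_lower_bound f_convex f_diff g_proper xs_min algo f_smooth.
set U := Useq _ _ _ _ _ _ _ in U0 *.
(* the added 1 keeps the constant positive when U_1 = 0 *)
apply/eqO_exP; exists (U / (2 * c) + 1).
  by rewrite ltr_wpDl// divr_ge0// mulr_ge0// ltW.
near=> k; have k0 : (0 < k)%N by near: k; exact: nbhs_infty_gt.
have kR : 0 < k%:R :> R by rewrite ltr0n.
have Sc : k%:R * c <= Sseq f x alpha k.
  exact: (Sseq_ge f_convex f_diff algo k hc).
have S0 : 0 < Sseq f x alpha k by apply: lt_le_trans Sc; rewrite mulr_gt0.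
rewrite !ger0_norm ?invr_ge0 ?ler0n//; last first.
  by rewrite divr_ge0// mulr_ge0// ltW.
apply: (@le_trans _ _ (U / (2 * c) / k%:R)).
  rewrite -mulrA -invfM ler_wpM2l// lef_pV2 ?posrE ?mulr_gt0//.
  by rewrite -mulrA ler_pM2l// mulrC.
by rewrite ler_wpM2r ?invr_ge0 ?ler0n// lerDl.
Unshelve. all: by end_near. Qed.
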